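(* For ai-semiring varieties $\mathcal V$ and $(\mathcal V_i)_{i\in I}$ and positive integers $m,n$, the following hold. (i) $\mathscr M_1(\mathcal V)=\mathcal V$; (ii) $\mathscr M_m(\mathscr M_n(\mathcal V))=\mathscr M_{mn}(\mathcal V)$; (iii) $\mathscr M_n\left(\bigvee_{i\in I}\mathcal V_i\right)=\bigvee_{i\in I}\mathscr M_n(\mathcal V_i)$; (iv) $\mathcal V\le\mathscr M_n(\mathcal V)$; (v) if $n\le m$, then $\mathscr M_n(\mathcal V)\le\mathscr M_m(\mathcal V)$.
   Context: An additively idempotent semiring (ai-semiring) is an algebra $(S,+,\cdot)$ in the signature of two binary operations with $(S,+)$ a commutative idempotent semigroup, $(S,\cdot)$ a semigroup, and multiplication distributing over addition on both sides. For an ai-semiring $S$ and $n\ge1$, $M_n(S)$ is the ai-semiring of all $n\times n$ matrices over $S$ with entrywise addition and usual matrix multiplication. The ai-semiring varieties form a lattice under inclusion $\le$, with join $\bigvee$. For an ai-semiring variety $\mathcal V$ and $n\ge1$, $\mathscr M_n(\mathcal V)$ is the variety generated by $\{M_n(S):S\in\mathcal V\}$. *)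

(* Defs.v *)
From HB Require Import structures.
From mathcomp Require Import all_boot all_algebra.
From mathcomp Require Import boolp.

Set Implicit Arguments.
Unset Strict Implicit.
Unset Printing Implicit Defensive.

Declare Scope ai_scope.
Delimit Scope ai_scope with ai.

(* No zero and no unit are required, so this cannot be built on the library's
   semirings.  As usual in universal algebra, carriers are nonempty. *)
HB.mixin Record isAiSemiring S := {
  ai_add : S -> S -> S;
  ai_mul : S -> S -> S;
  ai_inhabited : inhabited S;
  ai_addA : associative ai_add;
  ai_addC : commutative ai_add;
  ai_addxx : idempotent_op ai_add;
  ai_mulA : associative ai_mul;
  ai_mulDl : left_distributive ai_mul ai_add;
  ai_mulDr : right_distributive ai_mul ai_add
}.

#[short(type="aiSemiringType")]
HB.structure Definition AiSemiring := {S of isAiSemiring S}.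

Bind Scope ai_scope with AiSemiring.sort.
Notation "x + y" := (ai_add x y) : ai_scope.
Notation "x * y" := (ai_mul x y) : ai_scope.
Local Open Scope ai_scope.

HB.instance Definition _ (S : aiSemiringType) :=
  SemiGroup.isComLaw.Build S (@ai_add S) (@ai_addA S) (@ai_addC S).

(* The sum of f over 'I_n.  There is no neutral element to start from, so the
   sum starts at the term of index i0; aisumE shows that i0 is immaterial. *)
Definition aisum (S : aiSemiringType) n (i0 : 'I_n) (f : 'I_n -> S) : S :=
  \big[@ai_add S/f i0]_(k < n | k != i0) f k.

Section AiSum.
Variable S : aiSemiringType.
Local Notation oadd := (oAC (@ai_addA S) (@ai_addC S)).

Lemma aisumE n (i0 : 'I_n) (f : 'I_n -> S) :
  Some (aisum i0 f) = \big[oadd/None]_(k < n) Some (f k).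
Proof.
rewrite /aisum (some_big_AC_mk_monoid (@ai_addA S) (@ai_addC S)).
by rewrite [RHS](bigD1 i0) //= Monoid.mulmC.
Qed.

Lemma aisum_irrel n (i0 j0 : 'I_n) (f : 'I_n -> S) : aisum i0 f = aisum j0 f.
Proof. by apply: Some_inj; rewrite !aisumE. Qed.

Lemma eq_aisum n (i0 : 'I_n) (f g : 'I_n -> S) :
  f =1 g -> aisum i0 f = aisum i0 g.
Proof. by move=> fg; rewrite /aisum fg; apply: eq_bigr => k _. Qed.

Lemma aisumD n (i0 : 'I_n) (f g : 'I_n -> S) :
  aisum i0 (fun k => f k + g k) = aisum i0 f + aisum i0 g.
Proof.
apply: Some_inj; rewrite -(oACE (@ai_addA S) (@ai_addC S)) !aisumE -big_split.
by apply: eq_bigr => k _.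
Qed.

Lemma aisum_mull n (i0 : 'I_n) (f : 'I_n -> S) x :
  x * aisum i0 f = aisum i0 (fun k => x * f k).
Proof.
rewrite /aisum; elim/big_rec2: _ => // k y z _ <-.
by rewrite ai_mulDr.
Qed.

Lemma aisum_mulr n (i0 : 'I_n) (f : 'I_n -> S) x :
  aisum i0 f * x = aisum i0 (fun k => f k * x).
Proof.
rewrite /aisum; elim/big_rec2: _ => // k y z _ <-.
by rewrite ai_mulDl.
Qed.

Lemma exchange_aisum n p (i0 : 'I_n) (j0 : 'I_p) (f : 'I_n -> 'I_p -> S) :
  aisum i0 (fun k => aisum j0 (fun l => f k l)) =
  aisum j0 (fun l => aisum i0 (fun k => f k l)).
Proof.
apply: Some_inj; rewrite !aisumE.
rewrite (eq_bigr _ (fun k _ => aisumE j0 (f k))) exchange_big /=.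
by apply: eq_bigr => l _; rewrite aisumE.
Qed.

End AiSum.

(* The library's product of matrices requires a zero. *)
Section MatrixAiSemiring.
Variables (S : aiSemiringType) (n : nat).
Implicit Types A B C : 'M[S]_n.

Definition aimx_add A B : 'M[S]_n := \matrix_(i, j) (A i j + B i j).

Definition aimx_mul A B : 'M[S]_n :=
  \matrix_(i, j) aisum i (fun k => A i k * B k j).

Fact aimx_inhabited : inhabited 'M[S]_n.
Proof. by have [x] := @ai_inhabited S; constructor; exact: const_mx x. Qed.

Fact aimx_addA : associative aimx_add.
Proof. by move=> A B C; apply/matrixP => i j; rewrite !mxE ai_addA. Qed.

Fact aimx_addC : commutative aimx_add.
Proof. by move=> A B; apply/matrixP => i j; rewrite !mxE ai_addC. Qed.

Fact aimx_addxx : idempotent_op aimx_add.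
Proof. by move=> A; apply/matrixP => i j; rewrite !mxE ai_addxx. Qed.

Fact aimx_mulA : associative aimx_mul.
Proof.
move=> A B C; apply/matrixP => i j; rewrite !mxE.
under eq_aisum do rewrite mxE (aisum_irrel _ i) aisum_mull.
under [RHS]eq_aisum do rewrite mxE aisum_mulr.
rewrite exchange_aisum; apply: eq_aisum => k; apply: eq_aisum => l.
by rewrite ai_mulA.
Qed.

Fact aimx_mulDl : left_distributive aimx_mul aimx_add.
Proof.
move=> A B C; apply/matrixP => i j; rewrite !mxE -aisumD.
by apply: eq_aisum => k; rewrite mxE ai_mulDl.
Qed.

Fact aimx_mulDr : right_distributive aimx_mul aimx_add.
Proof.
move=> A B C; apply/matrixP => i j; rewrite !mxE -aisumD.
by apply: eq_aisum => k; rewrite mxE ai_mulDr.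
Qed.

HB.instance Definition _ := isAiSemiring.Build 'M[S]_n aimx_inhabited
  aimx_addA aimx_addC aimx_addxx aimx_mulA aimx_mulDl aimx_mulDr.

End MatrixAiSemiring.

Definition ai_prod (I : Type) (F : I -> aiSemiringType) : Type :=
  forall i, F i.

Section ProductAiSemiring.
Variables (I : Type) (F : I -> aiSemiringType).
Implicit Types x y z : ai_prod F.

Definition ai_prod_add x y : ai_prod F := fun i => x i + y i.
Definition ai_prod_mul x y : ai_prod F := fun i => x i * y i.

Fact ai_prod_inhabited : inhabited (ai_prod F).
Proof.
have wit i : {x : F i | True}.
  by apply: cid; have [x] := @ai_inhabited (F i); exists x.
by constructor => i; exact: sval (wit i).
Qed.

Fact ai_prod_addA : associative ai_prod_add.
Proof.
by move=> x y z; apply: functional_extensionality_dep => i;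
  exact: ai_addA.
Qed.

Fact ai_prod_addC : commutative ai_prod_add.
Proof.
by move=> x y; apply: functional_extensionality_dep => i;
  exact: ai_addC.
Qed.

Fact ai_prod_addxx : idempotent_op ai_prod_add.
Proof.
by move=> x; apply: functional_extensionality_dep => i;
  exact: ai_addxx.
Qed.

Fact ai_prod_mulA : associative ai_prod_mul.
Proof.
by move=> x y z; apply: functional_extensionality_dep => i;
  exact: ai_mulA.
Qed.

Fact ai_prod_mulDl : left_distributive ai_prod_mul ai_prod_add.
Proof.
by move=> x y z; apply: functional_extensionality_dep => i;
  exact: ai_mulDl.
Qed.

Fact ai_prod_mulDr : right_distributive ai_prod_mul ai_prod_add.
Proof.
by move=> x y z; apply: functional_extensionality_dep => i;
  exact: ai_mulDr.
Qed.

HB.instance Definition _ := isAiSemiring.Build (ai_prod F) ai_prod_inhabited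
  ai_prod_addA ai_prod_addC ai_prod_addxx
  ai_prod_mulA ai_prod_mulDl ai_prod_mulDr.

End ProductAiSemiring.

Definition ai_morphism (S T : aiSemiringType) (f : S -> T) : Prop :=
  {morph f : x y / x + y} /\ {morph f : x y / x * y}.

(* Classes of ai-semirings are plain predicates: the carrier types live in the
   same universe as the argument of mathcomp.classical's set, so that
   set aiSemiringType is ill-typed. *)
Definition ai_class := aiSemiringType -> Prop.

Definition ai_class_sub (V W : ai_class) : Prop := forall S, V S -> W S.
Definition ai_class_eq (V W : ai_class) : Prop := forall S, V S <-> W S.

Declare Scope ai_class_scope.
Delimit Scope ai_class_scope with aic.
Bind Scope ai_class_scope with ai_class.
Notation "V <= W" := (ai_class_sub V W) : ai_class_scope.
Notation "V =c W" := (ai_class_eq V W)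
  (at level 70, no associativity) : ai_class_scope.

(* Closure under subalgebras is stated for all embeddings.  As the closure
   under surjective morphisms includes isomorphic copies, this is the usual
   notion.  I may be empty in the closure under products, so a variety always
   contains the one-element ai-semirings. *)
Record ai_variety (V : ai_class) : Prop := AiVariety {
  ai_variety_sub : forall (S T : aiSemiringType) (f : S -> T),
    ai_morphism f -> injective f -> V T -> V S;
  ai_variety_quo : forall (S T : aiSemiringType) (f : S -> T),
    ai_morphism f -> (forall y, exists x, f x = y) -> V S -> V T;
  ai_variety_prod : forall (I : Type) (F : I -> aiSemiringType),
    (forall i, V (F i)) -> V (ai_prod F)
}.

Definition variety_generated (K : ai_class) : ai_class :=
  fun S => forall W : ai_class, ai_variety W -> (K <= W)%aic -> W S.

Lemma variety_generatedP K : ai_variety (variety_generated K).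
Proof.
split.
- by move=> S T f fM fI VT W Wv KW; apply: (ai_variety_sub Wv fM fI); apply: VT.
- by move=> S T f fM fS VS W Wv KW; apply: (ai_variety_quo Wv fM fS); apply: VS.
- by move=> I F VF W Wv KW; apply: (ai_variety_prod Wv) => i; apply: VF.
Qed.

Definition variety_join (I : Type) (V : I -> ai_class) : ai_class :=
  variety_generated (fun S => exists i, V i S).

Definition matrix_variety (n : nat) (V : ai_class) : ai_class :=
  variety_generated (fun T => exists2 S, V S & T = 'M[S]_n).

(* Main.v *)
Require Import Defs.
From mathcomp Require Import all_boot.
From mathcomp Require Import all_algebra boolp.

(** Three facts carry the proof.

    The first is that sums in an ai-semiring are suprema for the order
    [x + y = y] ([aisum_lub]).  Hence a finite sum depends only on the set of
    its terms, and may be reindexed along any surjection ([aisum_surj]) or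
    split into a nested sum ([aisum_pair]).

    The second is that, for a variety [U], the ai-semirings whose n-by-n
    matrices lie in [U] again form a variety ([matrix_preimage_variety]),
    because forming matrices preserves embeddings, surjections and products.
    So [matrix_variety n V <= U] holds as soon as [U] contains the matrices
    over the members of [V], and this remains true when [V] is replaced by any
    class that generates it ([matrix_variety_generated_min]): on varieties,
    [matrix_variety n] is the lower adjoint of a Galois connection.  Lower
    adjoints preserve joins, which is (iii), and compositions of them can be
    compared on the generators.

    The third is a supply of maps between matrix semirings: blocks give
    M_(mn)(S) = M_m(M_n(S)) for (ii), the unique entry gives M_1(S) = S for (i),
    and repeating rows and columns along a surjection of indices embeds M_n(S)
    into M_m(S) for (v).  The usual corner embedding would need a zero;
    repetition does not, since repeated summands are absorbed by idempotency.
    Finally (iv) is (v) with n = 1, by (i). *)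

Set Implicit Arguments.
Unset Strict Implicit.
Unset Printing Implicit Defensive.

Local Open Scope ai_scope.
Local Open Scope ai_class_scope.

(** * Finite sums as suprema *)

Section Sums.
Variable S : aiSemiringType.
Implicit Types x y : S.

Lemma ai_le_anti x y : x + y = y -> y + x = x -> x = y.
Proof. by move=> xy yx; rewrite -yx ai_addC xy. Qed.

Lemma ai_add_lub x1 x2 y : (x1 + x2) + y = y <-> x1 + y = y /\ x2 + y = y.
Proof.
split=> [le12 | [le1 le2]]; last by rewrite -ai_addA le2.
split; rewrite -le12 !ai_addA ?ai_addxx //.
by rewrite (ai_addC x2 x1) -(ai_addA x1 x2 x2) ai_addxx.
Qed.

(** The least-upper-bound property determines a sum, so that equalities of sums
    reduce to comparing sets of summands. *)
Lemma aisum_lub n (i0 : 'I_n) (f : 'I_n -> S) y :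
  aisum i0 f + y = y <-> forall k, f k + y = y.
Proof.
split=> [le_sum k | le_f]; last first.
  by rewrite /aisum; elim/big_rec: _ => // k x _ lex; apply/ai_add_lub.
(* With base point k, the sum starts at [f k], which is then absorbed by y. *)
rewrite (aisum_irrel i0 k) /aisum in le_sum.
by elim/big_rec: _ le_sum => // l x _ IHx /ai_add_lub[_ /IHx].
Qed.

Lemma aisum_ge n (i0 k : 'I_n) (f : 'I_n -> S) :
  f k + aisum i0 f = aisum i0 f.
Proof. by move: k; apply/(aisum_lub i0); rewrite ai_addxx. Qed.

Lemma aisum_surj m n (r : 'I_m -> 'I_n) (i0 : 'I_m) (j0 : 'I_n) (f : 'I_n -> S) :
  (forall j, exists i, r i = j) ->
  aisum i0 (fun i => f (r i)) = aisum j0 f.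
Proof.
move=> r_surj; apply: ai_le_anti; apply/aisum_lub => k; first exact: aisum_ge.
by have [i <-] := r_surj k; exact: (aisum_ge i0 i (fun i => f (r i))).
Qed.

Lemma aisum_pair m n (i0 : 'I_m) (j0 : 'I_n) (k0 : 'I_(m * n))
    (f : 'I_(m * n) -> S) :
  aisum i0 (fun i => aisum j0 (fun j => f (mxvec_index i j))) = aisum k0 f.
Proof.
apply: ai_le_anti; apply/aisum_lub => k.
  by apply/aisum_lub => l; exact: aisum_ge.
case/mxvec_indexP: k => i j.
have /aisum_lub le_sum :=
  aisum_ge i0 i (fun i => aisum j0 (fun j => f (mxvec_index i j))).
exact: le_sum.
Qed.

End Sums.

Lemma aisum_morph (S T : aiSemiringType) (g : S -> T) n (i0 : 'I_n)
    (f : 'I_n -> S) :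
  {morph g : x y / x + y} ->
  g (aisum i0 f) = aisum i0 (fun k => g (f k)).
Proof.
by move=> gD; rewrite /aisum; elim/big_rec2: _ => // k y z _ <-; rewrite gD.
Qed.

(** * Morphisms between matrix semirings *)

Section MatrixEntries.
Variables (S : aiSemiringType) (n : nat).
Implicit Types A B : 'M[S]_n.

(** The base point of the sum is left free, as different constructions need
    different ones. *)
Lemma aimx_mulE A B (k0 i j : 'I_n) :
  (A * B) i j = aisum k0 (fun k => A i k * B k j).
Proof. by rewrite mxE (aisum_irrel i k0). Qed.

Lemma aimx_sumE m (i0 : 'I_m) (F : 'I_m -> 'M[S]_n) i j :
  aisum i0 F i j = aisum i0 (fun k => F k i j).
Proof. by apply: (aisum_morph (g := fun A => A i j)) => A B; rewrite mxE. Qed.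

End MatrixEntries.

Lemma map_mx_morphism (S T : aiSemiringType) (f : S -> T) n :
  ai_morphism f -> ai_morphism (fun A : 'M[S]_n => map_mx f A : 'M[T]_n).
Proof.
move=> [fD fM]; split=> A B; apply/matrixP=> i j.
  by rewrite !mxE fD.
rewrite (aimx_mulE _ _ i) mxE (aimx_mulE _ _ i) aisum_morph //.
by apply: eq_aisum => k; rewrite fM !mxE.
Qed.

Lemma inj_map_mx (S T : Type) (f : S -> T) m n :
  injective f -> injective (map_mx f : 'M[S]_(m, n) -> 'M[T]_(m, n)).
Proof.
move=> f_inj A B /matrixP eqAB; apply/matrixP=> i j.
by have := eqAB i j; rewrite !mxE => /f_inj.
Qed.

Lemma map_mx_surj (S T : Type) (f : S -> T) m n :
  (forall y, exists x, f x = y) ->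
  forall B : 'M[T]_(m, n), exists A, map_mx f A = B.
Proof.
move=> /choice[g gK] B; exists (map_mx g B).
by apply/matrixP=> i j; rewrite !mxE gK.
Qed.

Section MatrixOfProduct.
Variables (I : Type) (F : I -> aiSemiringType) (n : nat).

Definition mx_components (A : 'M[ai_prod F]_n) :
    ai_prod (fun i => 'M[F i]_n : aiSemiringType) :=
  fun i => map_mx (fun x => x i) A.

Lemma mx_components_morphism : ai_morphism mx_components.
Proof.
have proj i : ai_morphism (fun x : ai_prod F => x i) by split.
split=> A B; apply: functional_extensionality_dep => i.
  exact: (map_mx_morphism n (proj i)).1.
exact: (map_mx_morphism n (proj i)).2.
Qed.

Lemma mx_components_inj : injective mx_components.
Proof.
move=> A B eqAB; apply/matrixP=> k l; apply: functional_extensionality_dep => i.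
by have /matrixP/(_ k l) := congr1 (fun x => x i) eqAB; rewrite !mxE.
Qed.

End MatrixOfProduct.

Lemma scalar_entry_morphism (S : aiSemiringType) :
  ai_morphism (fun A : 'M[S]_1 => A ord0 ord0).
Proof.
split=> A B; rewrite mxE // /aisum big_pred0 // => k.
by rewrite (ord1 k) eqxx.
Qed.

Section Repetition.
Variables (S : aiSemiringType) (m n : nat) (r : 'I_m -> 'I_n).
Hypothesis r_surj : forall j, exists i, r i = j.

Lemma mxsub_morphism : ai_morphism (mxsub r r : 'M[S]_n -> 'M[S]_m).
Proof.
split=> A B; apply/matrixP=> i j; first by rewrite !mxE.
rewrite (aimx_mulE _ _ i) mxE (aimx_mulE _ _ (r i)).
rewrite -(aisum_surj i _ (fun k => A (r i) k * B k (r j)) r_surj).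
by apply: eq_aisum => k; rewrite !mxE.
Qed.

Lemma mxsub_inj : injective (mxsub r r : 'M[S]_n -> 'M[S]_m).
Proof.
move=> A B /matrixP eqAB; apply/matrixP=> i j.
have [[k <-] [l <-]] := (r_surj i, r_surj j).
by have := eqAB k l; rewrite !mxE.
Qed.

End Repetition.

Section Blocks.
Variables (S : aiSemiringType) (m n : nat).

Definition mx_blocks (A : 'M[S]_(m * n)) : 'M['M[S]_n]_m :=
  (\matrix_(i, j) \matrix_(k, l) A (mxvec_index i k) (mxvec_index j l))%R.

Lemma mx_blocksE A i j k l :
  mx_blocks A i j k l = A (mxvec_index i k) (mxvec_index j l).
Proof. by rewrite !mxE. Qed.

Lemma mx_blocks_morphism : ai_morphism mx_blocks.
Proof.
split=> A B; apply/matrixP=> i j; apply/matrixP=> k l; first by rewrite !mxE.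
rewrite mx_blocksE (aimx_mulE _ _ (mxvec_index i k)) (aimx_mulE _ _ i).
rewrite aimx_sumE -(aisum_pair i k); apply: eq_aisum => p.
rewrite (aimx_mulE _ _ k); apply: eq_aisum => q.
by rewrite !mx_blocksE.
Qed.

Lemma mx_blocks_inj : injective mx_blocks.
Proof.
move=> A B eqAB; apply/matrixP=> i j.
case/mxvec_indexP: i => i k; case/mxvec_indexP: j => j l.
by rewrite -!mx_blocksE eqAB.
Qed.

Lemma mx_blocks_surj (B : 'M['M[S]_n]_m) : exists A, mx_blocks A = B.
Proof.
have [g gK] : exists g : 'I_(m * n) -> 'I_m * 'I_n,
    forall i k, g (mxvec_index i k) = (i, k).
  have [g gK _] := @curry_mxvec_bij m n.
  by exists g => i k; apply: (gK (i, k)).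
exists (\matrix_(p, q) B (g p).1 (g q).1 (g p).2 (g q).2)%R.
apply/matrixP=> i j; apply/matrixP=> k l.
by rewrite mx_blocksE mxE !gK.
Qed.

End Blocks.

(** * Matrix varieties as lower adjoints *)

Lemma variety_generated_ge (K : ai_class) : K <= variety_generated K.
Proof. by move=> S KS U _; apply. Qed.

Lemma variety_generated_min (K U : ai_class) :
  ai_variety U -> K <= U -> variety_generated K <= U.
Proof. by move=> hU KU S; apply. Qed.

Lemma mem_matrix_variety n (V : ai_class) (S : aiSemiringType) :
  V S -> matrix_variety n V ('M[S]_n : aiSemiringType).
Proof. by move=> VS; apply: variety_generated_ge; exists S. Qed.

Definition matrix_preimage n (U : ai_class) : ai_class :=
  fun S => U ('M[S]_n : aiSemiringType).

Lemma matrix_preimage_variety n U :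
  ai_variety U -> ai_variety (matrix_preimage n U).
Proof.
move=> hU; split.
- move=> S T f fM f_inj.
  apply: (ai_variety_sub hU (map_mx_morphism n fM)).
  exact: inj_map_mx.
- move=> S T f fM f_surj.
  apply: (ai_variety_quo hU (map_mx_morphism n fM)).
  exact: map_mx_surj.
- move=> I F UF.
  apply: (ai_variety_sub hU (@mx_components_morphism I F n)).
    exact: mx_components_inj.
  exact: ai_variety_prod.
Qed.

Lemma matrix_variety_min n (V U : ai_class) :
  ai_variety U -> V <= matrix_preimage n U -> matrix_variety n V <= U.
Proof.
by move=> hU VU; apply: variety_generated_min => // _ [S VS ->]; exact: VU.
Qed.

(** A property of matrices that defines a variety need only be tested on
    matrices over generators. *)
Lemma matrix_variety_generated_min n (K U : ai_class) :
  ai_variety U -> K <= matrix_preimage n U ->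
  matrix_variety n (variety_generated K) <= U.
Proof.
move=> hU KU; apply: matrix_variety_min => //.
by apply: variety_generated_min => //; exact: matrix_preimage_variety.
Qed.

Lemma matrix_variety_variety n V : ai_variety (matrix_variety n V).
Proof. exact: variety_generatedP. Qed.

Lemma matrix_variety_mono n (V U : ai_class) :
  V <= U -> matrix_variety n V <= matrix_variety n U.
Proof.
move=> VU; apply: matrix_variety_min; first exact: matrix_variety_variety.
by move=> S /VU; exact: mem_matrix_variety.
Qed.

(** * The laws of matrix varieties *)

Lemma matrix_variety1 V : ai_variety V -> matrix_variety 1 V =c V.
Proof.
move=> hV S; split.
  apply: matrix_variety_min => // {}S.
  apply: (ai_variety_sub hV (@scalar_entry_morphism S)) => A B eqAB.
  by apply/matrixP=> i j; rewrite !ord1.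
move=> VS; have := mem_matrix_variety (n := 1) VS.
apply: (ai_variety_quo (matrix_variety_variety 1 V) (@scalar_entry_morphism S)).
by move=> x; exists (const_mx x); rewrite mxE.
Qed.

Lemma matrix_variety_comp m n V :
  matrix_variety m (matrix_variety n V) =c matrix_variety (m * n)%N V.
Proof.
have hmn := matrix_variety_variety (m * n) V.
have hm := matrix_variety_variety m (matrix_variety n V).
move=> S; split.
  apply: matrix_variety_generated_min => // _ [T VT ->].
  apply: (ai_variety_quo hmn (@mx_blocks_morphism T m n)).
    exact: mx_blocks_surj.
  exact: mem_matrix_variety.
apply: matrix_variety_min => // T VT.
apply: (ai_variety_sub hm (@mx_blocks_morphism T m n)).
  exact: mx_blocks_inj.
by do 2![apply: mem_matrix_variety].
Qed.

Lemma matrix_variety_join n I (W : I -> ai_class) :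
  matrix_variety n (variety_join W) =c
    variety_join (fun i => matrix_variety n (W i)).
Proof.
move=> S; split.
  apply: matrix_variety_generated_min; first exact: variety_generatedP.
  move=> T [i WT]; apply: variety_generated_ge; exists i.
  exact: mem_matrix_variety.
apply: variety_generated_min; first exact: matrix_variety_variety.
move=> T [i]; apply: matrix_variety_mono => R WR.
by apply: variety_generated_ge; exists i.
Qed.

Lemma matrix_variety_le m n V :
  (0 < n)%N -> (n <= m)%N -> matrix_variety n V <= matrix_variety m V.
Proof.
case: n => // n _ le_nm.
have hm := matrix_variety_variety m V.
apply: matrix_variety_min => // S VS.
(* [inord] sends every index from n on to 0, so the first row and column are
   the ones that get repeated. *)
pose r (i : 'I_m) : 'I_n.+1 := inord i.
have r_surj j : exists i, r i = j.
  by exists (widen_ord le_nm j); exact: inord_val.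
apply: (ai_variety_sub hm (mxsub_morphism S r_surj)).
  exact: mxsub_inj.
exact: mem_matrix_variety.
Qed.

Theorem theorem9p1 (V : ai_class) (I : Type) (W : I -> ai_class) (m n : nat)
    (hV : ai_variety V) (hW : forall i, ai_variety (W i))
    (hm : (0 < m)%N) (hn : (0 < n)%N) :
  [/\ matrix_variety 1 V =c V,
      matrix_variety m (matrix_variety n V) =c matrix_variety (m * n)%N V,
      matrix_variety n (variety_join W) =c
        variety_join (fun i => matrix_variety n (W i)),
      V <= matrix_variety n V
    & (n <= m)%N -> matrix_variety n V <= matrix_variety m V].
Proof.
split.
- exact: matrix_variety1.
- exact: matrix_variety_comp.
- exact: matrix_variety_join.
- by move=> S /(matrix_variety1 hV S); exact: matrix_variety_le.
- exact: matrix_variety_le.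
Qed.
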